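(* Let $V=\{1,\dots,N\}$ and let $F$ be a finite set of nonempty subsets of $V$ (hyperedges). Consider the factor graph model $p(x)=Z^{-1}\prod_{\lambda\in F}\psi_\lambda(x_\lambda)$ on $x\in\{\pm1\}^V$, with positive functions $\psi_\lambda$ and $Z=\sum_x\prod_\lambda\psi_\lambda(x_\lambda)$. Let a fixed point of loopy belief propagation be given, with beliefs $b_i,b_\lambda$, Bethe approximation $Z_B$, and quantities $\gamma_i$, $\beta^\lambda_I$ as defined in the context. Then \[ Z=Z_B\sum_{s\subset E_H}(-1)^{|s|}\prod_{\lambda\in F}\beta^\lambda_{I_\lambda(s)}\prod_{i\in V}f_{d_i(s)}(\gamma_i). \]
   Context: $x_\lambda=(x_i)_{i\in\lambda}$. $G_H$ is the bipartite graph with vertex set $V\cup F$ and an edge $(i,\lambda)$ whenever $i\in\lambda$; $E_H$ is its edge set. For $s\subset E_H$, $d_i(s)$ is the number of edges of $s$ incident to $i\in V$, and $I_\lambda(s)=\{i\in\lambda:(i,\lambda)\in s\}$. $d_i$ is the number of $\lambda\in F$ containing $i$. The polynomials $f_n$ satisfy $f_0(x)=1$, $f_1(x)=0$, $f_{n+1}(x)=xf_n(x)+f_{n-1}(x)$. A fixed point of LBP consists of positive functions $\mu_{\lambda\to i}(x_i)$ and $\nu_{i\to\lambda}(x_i)$ for each pair $i\in\lambda\in F$ such that, for suitable positive constants, $\mu_{\lambda\to i}(x_i)\propto\sum_{x_{\lambda\setminus\{i\}}}\psi_\lambda(x_\lambda)\prod_{j\in\lambda,j\ne i}\nu_{j\to\lambda}(x_j)$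 and $\nu_{i\to\lambda}(x_i)\propto\prod_{\mu\ni i,\mu\ne\lambda}\mu_{\mu\to i}(x_i)$. Beliefs: $b_i(x_i)\propto\prod_{\mu\ni i}\mu_{\mu\to i}(x_i)$ and $b_\lambda(x_\lambda)\propto\psi_\lambda(x_\lambda)\prod_{j\in\lambda}\nu_{j\to\lambda}(x_j)$, each normalized to sum to $1$. The Bethe approximation: $\log Z_B=\sum_{\lambda}\sum_{x_\lambda}b_\lambda\log\psi_\lambda-\sum_\lambda\sum_{x_\lambda}b_\lambda\log b_\lambda+\sum_{i\in V}(d_i-1)\sum_{x_i}b_i\log b_i$. Let $\xi_i=\sqrt{b_i(1)/b_i(-1)}$, so $b_i(x_i)=\xi_i^{x_i}/(\xi_i+\xi_i^{-1})$, and $\gamma_i=\frac{b_i(1)-b_i(-1)}{\sqrt{b_i(1)b_i(-1)}}=\xi_i-\xi_i^{-1}$. For $\lambda\in F$ and $I\subset\lambda$, the numbers $\beta^\lambda_I$ are defined by $\beta^\lambda_\emptyset=1$, $\beta^\lambda_I=0$ if $|I|=1$, and, for $|I|\ge2$, as the (unique) real numbers such that $b_\lambda(x_\lambda)=\frac{1}{\prod_{i\in\lambda}(\xi_i+\xi_i^{-1})}\sum_{I\subset\lambda}\beta^\lambda_I\prod_{i\in I}x_i\prod_{j\in\lambda\setminus I}\xi_j^{x_j}$ for all $x_\lambda$. *)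

(* Defs.v *)
From HB Require Import structures.
From mathcomp Require Import all_boot all_order all_algebra.
From mathcomp Require Import ring.
From mathcomp Require Import all_classical all_reals all_analysis.

Set Implicit Arguments.
Unset Strict Implicit.
Unset Printing Implicit Defensive.

Import Order.TTheory GRing.Theory Num.Theory.
Local Open Scope ring_scope.

(* The elements of a hyperedge, as a finite type.  Sets of type
   {set members A} are exactly the subsets of A. *)
Notation members A := {i | i \in A}.

(* Configurations of a set of vertices: bool encodes {+1, -1} through spin. *)
Notation config N := {ffun 'I_N -> bool}.
Notation local_config A := {ffun members A -> bool}.

Definition spin (a : bool) : int := if a then 1 else -1.

Definition restrict (N : nat) (A : {set 'I_N}) (x : config N) :
  local_config A := [ffun j => x (val j)].

Definition partition_function (R : realType) (N : nat) (F : {set {set 'I_N}})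
    (psi : forall A : {set 'I_N}, local_config A -> R) : R :=
  \sum_(x : config N) \prod_(A in F) psi A (restrict A x).

Definition edges (N : nat) (F : {set {set 'I_N}}) :
  {set 'I_N * {set 'I_N}} := [set e | (e.2 \in F) && (e.1 \in e.2)].

Definition degree (N : nat) (F : {set {set 'I_N}}) (i : 'I_N) : nat :=
  #|[set A in F | i \in A]|.

Definition edge_degree (N : nat) (s : {set 'I_N * {set 'I_N}}) (i : 'I_N) :
  nat := #|[set e in s | e.1 == i]|.

Definition edge_trace (N : nat) (s : {set 'I_N * {set 'I_N}})
    (A : {set 'I_N}) : {set members A} :=
  [set i : members A | (val i, A) \in s].

Fixpoint fpoly (R : realType) (n : nat) : {poly R} :=
  match n with
  | 0%N => 1
  | n'.+1 => match n' with
             | 0%N => 0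
             | n''.+1 => 'X * fpoly R n' + fpoly R n''
             end
  end.

(* mu A i is the message from the hyperedge A to the vertex i, and nu i A the
   message from i to A; their values are irrelevant unless i \in A \in F. *)
Definition lbp_fixed_point (R : realType) (N : nat) (F : {set {set 'I_N}})
    (psi : forall A : {set 'I_N}, local_config A -> R)
    (mu : {set 'I_N} -> 'I_N -> bool -> R)
    (nu : 'I_N -> {set 'I_N} -> bool -> R) : Prop :=
  forall A : {set 'I_N}, A \in F -> forall i : members A,
  [/\ forall a, 0 < mu A (val i) a,
      forall a, 0 < nu (val i) A a,
      exists2 c : R, 0 < c & forall a,
        mu A (val i) a =
          c * \sum_(y : local_config A | y i == a)
                psi A y * \prod_(j : members A | j != i) nu (val j) A (y j)
    & exists2 c : R, 0 < c & forall a,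
        nu (val i) A a =
          c * \prod_(B in F | (val i \in B) && (B != A)) mu B (val i) a].

Definition vertex_weight (R : realType) (N : nat) (F : {set {set 'I_N}})
    (mu : {set 'I_N} -> 'I_N -> bool -> R) (i : 'I_N) (a : bool) : R :=
  \prod_(B in F | i \in B) mu B i a.

Definition vertex_belief (R : realType) (N : nat) (F : {set {set 'I_N}})
    (mu : {set 'I_N} -> 'I_N -> bool -> R) (i : 'I_N) (a : bool) : R :=
  vertex_weight F mu i a / \sum_(a' : bool) vertex_weight F mu i a'.

Definition factor_weight (R : realType) (N : nat)
    (psi : forall A : {set 'I_N}, local_config A -> R)
    (nu : 'I_N -> {set 'I_N} -> bool -> R)
    (A : {set 'I_N}) (y : local_config A) : R :=
  psi A y * \prod_(j : members A) nu (val j) A (y j).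

Definition factor_belief (R : realType) (N : nat)
    (psi : forall A : {set 'I_N}, local_config A -> R)
    (nu : 'I_N -> {set 'I_N} -> bool -> R)
    (A : {set 'I_N}) (y : local_config A) : R :=
  factor_weight psi nu y
    / \sum_(y' : local_config A) factor_weight psi nu y'.

Definition bethe_log (R : realType) (N : nat) (F : {set {set 'I_N}})
    (psi : forall A : {set 'I_N}, local_config A -> R)
    (mu : {set 'I_N} -> 'I_N -> bool -> R)
    (nu : 'I_N -> {set 'I_N} -> bool -> R) : R :=
  \sum_(A in F) \sum_(y : local_config A)
      factor_belief psi nu y * ln (psi A y)
  - \sum_(A in F) \sum_(y : local_config A)
      factor_belief psi nu y * ln (factor_belief psi nu y)
  + \sum_(i < N) ((degree F i)%:R - 1) *
      \sum_(a : bool) vertex_belief F mu i a * ln (vertex_belief F mu i a).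

Definition bethe_Z (R : realType) (N : nat) (F : {set {set 'I_N}})
    (psi : forall A : {set 'I_N}, local_config A -> R)
    (mu : {set 'I_N} -> 'I_N -> bool -> R)
    (nu : 'I_N -> {set 'I_N} -> bool -> R) : R :=
  expR (bethe_log F psi mu nu).

Definition xi (R : realType) (N : nat) (F : {set {set 'I_N}})
    (mu : {set 'I_N} -> 'I_N -> bool -> R) (i : 'I_N) : R :=
  Num.sqrt (vertex_belief F mu i true / vertex_belief F mu i false).

Definition gamma (R : realType) (N : nat) (F : {set {set 'I_N}})
    (mu : {set 'I_N} -> 'I_N -> bool -> R) (i : 'I_N) : R :=
  (vertex_belief F mu i true - vertex_belief F mu i false)
    / Num.sqrt (vertex_belief F mu i true * vertex_belief F mu i false).

(* The defining property of the coefficients beta^A_I, I \subset A; existence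
   and uniqueness at an LBP fixed point are proved in beta_exists_unique. *)
Definition is_beta (R : realType) (N : nat) (F : {set {set 'I_N}})
    (psi : forall A : {set 'I_N}, local_config A -> R)
    (mu : {set 'I_N} -> 'I_N -> bool -> R)
    (nu : 'I_N -> {set 'I_N} -> bool -> R)
    (A : {set 'I_N}) (b : {set members A} -> R) : Prop :=
  [/\ b finset.set0 = 1,
      forall I : {set members A}, #|I| = 1%N -> b I = 0
    & forall y : local_config A,
        factor_belief psi nu y =
          (\prod_(i in A) (xi F mu i + (xi F mu i)^-1))^-1 *
          \sum_(I : {set members A})
             b I * \prod_(i in I) (spin (y i))%:~R *
             \prod_(j in ~: I) xi F mu (val j) ^ spin (y j)].

Lemma expz_spin (R : realType) (u : R) (a : bool) :
  u ^ spin a = if a then u else u^-1.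
Proof. by case: a; rewrite /spin ?expr1z ?exprN1. Qed.

Lemma spin_expansion (R : realType) (T : finType) (u : T -> R)
    (g : {ffun T -> bool} -> R) (c : {set T} -> R) :
  (forall i, 0 < u i) ->
  (forall y, g y = (\prod_i (u i + (u i)^-1))^-1 *
     \sum_(I : {set T}) c I * \prod_(i in I) (spin (y i))%:~R *
        \prod_(j in ~: I) u j ^ spin (y j)) <->
  (forall I, c I =
     \sum_(y : {ffun T -> bool}) g y * \prod_(i in I) ((spin (y i))%:~R / u i ^ spin (y i))).
Proof.
move=> u_gt0.
have u_neq0 i : u i != 0 by rewrite gt_eqF.
have uV_gt0 i : 0 < u i + (u i)^-1 by rewrite addr_gt0 ?invr_gt0.
have P_neq0 : \prod_i (u i + (u i)^-1) != 0.
  by apply/prodf_neq0 => i _; rewrite gt_eqF.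
have splitE (I : {set T}) (h k : T -> R) :
    \prod_(i in I) h i * \prod_(j in ~: I) k j =
    \prod_i (if i \in I then h i else k i).
  rewrite [RHS](bigID (mem I)) /=; congr (_ * _).
    by apply: eq_bigr => i /= ->.
  by apply: eq_big => i; rewrite finset.in_setC // => /negPf ->.
split=> H.
  move=> I.
  transitivity (\sum_(y : {ffun T -> bool}) \sum_(J : {set T}) (\prod_i (u i + (u i)^-1))^-1 * c J *
     \prod_i ((if i \in J then (spin (y i))%:~R else u i ^ spin (y i)) *
        (if i \in I then (spin (y i))%:~R / u i ^ spin (y i) else 1))).
    rewrite exchange_big /=.
    have E (J : {set T}) :
        \prod_i \sum_(a : bool)
         ((if i \in J then (spin a)%:~R else u i ^ spin a) *
          (if i \in I then (spin a)%:~R / u i ^ spin a else 1)) =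
        if J == I then \prod_i (u i + (u i)^-1) else 0.
      case: (eqVneq J I) => [->|JI].
        apply: eq_bigr => i _; rewrite big_bool !expz_spin /=.
        by case: ifP => _; rewrite /spin; field.
      have [i Hi] : exists i, (i \in J) != (i \in I).
        apply/existsP; apply: contraNT JI => /existsPn Hn; apply/eqP/finset.setP => i.
        by have := Hn i; rewrite negbK => /eqP.
      rewrite (bigD1 i) //= big_bool !expz_spin /=.
      move: Hi; case: (i \in J); case: (i \in I) => //= _.
        by rewrite /spin !mulr1 mulr1z mulrN1z subrr mul0r.
      rewrite /spin; set z := _ + _; suff -> : z = 0 by rewrite mul0r.
      by rewrite /z; field.
    rewrite (eq_bigr (fun J => (\prod_i (u i + (u i)^-1))^-1 * c J *
       (if J == I then \prod_i (u i + (u i)^-1) else 0))).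
      rewrite (bigD1 I) //= eqxx [X in _ + X]big1 ?addr0.
        by rewrite mulrAC mulVf // mul1r.
      by move=> J /negPf ->; rewrite mulr0.
    move=> J _; rewrite -mulr_sumr; congr (_ * _).
    by rewrite -E bigA_distr_bigA.
  apply: eq_bigr => y _; rewrite H mulr_sumr mulr_suml; apply: eq_bigr => J _.
  rewrite big_split /= -splitE -!mulrA; congr (_ * (_ * (_ * (_ * _)))).
  by rewrite [RHS]big_mkcond.
move=> y.
transitivity ((\prod_i (u i + (u i)^-1))^-1 * \sum_(y' : {ffun T -> bool}) g y' *
    \prod_i ((spin (y' i))%:~R / u i ^ spin (y' i) * (spin (y i))%:~R +
             u i ^ spin (y i))).
  rewrite (bigD1 y) //= [X in _ + X]big1 ?addr0.
    rewrite [X in _ * (_ * X)](eq_bigr (fun i => u i + (u i)^-1)); first by field.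
    by move=> i _; rewrite !expz_spin /spin; case: (y i); field.
  move=> y' y'y.
  have [i Hi] : exists i, y' i != y i.
    apply/existsP; apply: contraNT y'y => /existsPn Hn; apply/eqP/ffunP => i.
    by have := Hn i; rewrite negbK => /eqP.
  rewrite (bigD1 i) //= !expz_spin /spin.
  set z := _ + _; suff -> : z = 0 by rewrite mul0r mulr0.
  by rewrite /z; move: Hi; case: (y' i); case: (y i) => // _; field.
congr (_ * _).
rewrite (eq_bigr (fun y' => \sum_(I : {set T}) g y' * (
   \prod_i (if i \in I then
      (spin (y' i))%:~R / u i ^ spin (y' i) * (spin (y i))%:~R
      else u i ^ spin (y i))))).
  rewrite exchange_big; apply: eq_bigr => I _ /=.
  rewrite H !mulr_suml; apply: eq_bigr => y' _.
  by rewrite -splitE big_split /= !mulrA.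
by move=> y' _; rewrite -mulr_sumr -bigA_distr.
Qed.

Lemma beta_exists_unique (R : realType) (N : nat) (F : {set {set 'I_N}})
    (psi : forall A : {set 'I_N}, local_config A -> R)
    (mu : {set 'I_N} -> 'I_N -> bool -> R)
    (nu : 'I_N -> {set 'I_N} -> bool -> R) (A : {set 'I_N}) :
  (forall B, B \in F -> forall y, 0 < psi B y) ->
  lbp_fixed_point F psi mu nu -> A \in F ->
  exists! b : {set members A} -> R, is_beta F psi mu nu b.
Proof.
move=> psi_gt0 fixP AF.
have vw_gt0 i a : 0 < vertex_weight F mu i a.
  apply: prodr_gt0 => B /andP[BF iB].
  by have [] := fixP B BF (exist _ i iB).
have vb_gt0 i a : 0 < vertex_belief F mu i a.
  by rewrite divr_gt0 // big_bool addr_gt0.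
have xi_gt0 i : 0 < xi F mu i by rewrite sqrtr_gt0 divr_gt0.
have vbE i a : vertex_belief F mu i a =
    xi F mu i ^ spin a / (xi F mu i + (xi F mu i)^-1).
  have : xi F mu i ^+ 2 * vertex_belief F mu i false = vertex_belief F mu i true.
    rewrite sqr_sqrtr; first by rewrite divfK // gt_eqF.
    by rewrite ltW // divr_gt0.
  have : vertex_belief F mu i true + vertex_belief F mu i false = 1.
    rewrite /vertex_belief -mulrDl -[X in X / _]big_bool divff // gt_eqF //.
    by rewrite big_bool addr_gt0.
  have := xi_gt0 i; rewrite expz_spin; move: (xi F mu i) => x x_gt0.
  have x_neq0 : x != 0 by rewrite gt_eqF.
  have x2_neq0 : x ^+ 2 + 1 != 0 by rewrite gt_eqF // addr_gt0 // exprn_gt0.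
  move=> sum1 trueE.
  have falseE : vertex_belief F mu i false = (x ^+ 2 + 1)^-1.
    by apply: (mulfI x2_neq0); rewrite mulfV // mulrDl mul1r trueE.
  by case: a; rewrite -?trueE falseE; field; rewrite x2_neq0 x_neq0.
have fw_gt0 y : 0 < factor_weight psi nu (A := A) y.
  rewrite mulr_gt0 ?psi_gt0 // prodr_gt0 // => j _.
  by have [] := fixP A AF j.
have fwS_gt0 : 0 < \sum_(y : local_config A) factor_weight psi nu y.
  rewrite (bigD1 [ffun=> true]) //= ltr_pwDl // sumr_ge0 // => y _.
  exact: ltW.
have marg (i : members A) a : \sum_(y : local_config A | y i == a)
    factor_belief psi nu y = vertex_belief F mu (val i) a.
  have [_ _ [c c_gt0 muE] [c' c'_gt0 nuE]] := fixP A AF i.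
  have wE a' : \sum_(y : local_config A | y i == a') factor_weight psi nu y =
      c' / c * vertex_weight F mu (val i) a'.
    transitivity (nu (val i) A a' * (mu A (val i) a' / c)).
      rewrite muE [c * _]mulrC mulfK ?gt_eqF // mulr_sumr.
      apply: eq_bigr => y /eqP <-.
      by rewrite /factor_weight (bigD1 i) //= mulrCA.
    rewrite nuE /vertex_weight [in RHS](bigD1 A) /=; last first.
      by rewrite AF; exact: (valP i).
    under [in RHS]eq_bigl do rewrite -andbA.
    by field; rewrite gt_eqF.
  have k0 : c' / c != 0 by rewrite gt_eqF // divr_gt0.
  rewrite -mulr_suml wE.
  rewrite (partition_big (fun y : local_config A => y i) xpredT) //=.
  rewrite (eq_bigr (fun a' => c' / c * vertex_weight F mu (val i) a')).
    by rewrite -mulr_sumr -mulf_div divff // mul1r.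
  by move=> a' _; exact: wE.
have PE : \prod_(i in A) (xi F mu i + (xi F mu i)^-1) =
    \prod_(i : members A) (xi F mu (val i) + (xi F mu (val i))^-1).
  by rewrite big_sub.
pose u (i : members A) := xi F mu (val i).
have u_gt0 i : 0 < u i by exact: xi_gt0.
pose b0 (I : {set members A}) : R := \sum_(y : local_config A)
  factor_belief psi nu y * \prod_(i in I) ((spin (y i))%:~R / u i ^ spin (y i)).
exists b0; split=> [|b [_ _]]; last first.
  rewrite PE => /(spin_expansion (factor_belief psi nu (A := A)) b u_gt0) H.
  by apply/funext => I; rewrite H.
split.
- rewrite /b0; under eq_bigr do rewrite finset.big_set0 mulr1.
  by rewrite -mulr_suml divff // gt_eqF.
- move=> I /eqP/cards1P[i ->].
  rewrite /b0; under eq_bigr do rewrite finset.big_set1.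
  rewrite (partition_big (fun y : local_config A => y i) xpredT) //=.
  rewrite (eq_bigr (fun a => vertex_belief F mu (val i) a *
      ((spin a)%:~R / u i ^ spin a))); last first.
    by move=> a _; rewrite -marg mulr_suml; apply: eq_bigr => y /eqP ->.
  rewrite big_bool !vbE -/(u i) !expz_spin /spin /=.
  have u0 : u i != 0 by rewrite gt_eqF.
  by field; rewrite u0 -expr2 gt_eqF // addr_gt0 // exprn_gt0.
- by rewrite PE; apply/(spin_expansion (factor_belief psi nu (A := A)) b0 u_gt0).
Qed.

(* Main.v *)
Require Import Defs.
From HB Require Import structures.
From mathcomp Require Import all_boot all_order all_algebra.
From mathcomp Require Import ring.
From mathcomp Require Import all_classical all_reals all_analysis.

Set Implicit Arguments.
Unset Strict Implicit.
Unset Printing Implicit Defensive.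

Import Order.TTheory GRing.Theory Num.Theory.
Local Open Scope ring_scope.

(* Write [b_i], [b_A] for the beliefs.  At a fixed point
     prod_A psi_A = Z_B * prod_A (b_A / prod_(i in A) b_i) * prod_i b_i
   pointwise: the logarithms of the two products of beliefs differ from that of
   the left-hand side by a constant, and averaging against the beliefs, which
   are consistent with each other, identifies the constant with [log Z_B].
   By definition of [beta], b_A / prod_(i in A) b_i is the sum over I of
   [beta A I] times prod_(i in I) x_i xi_i^(- x_i).  Expanding the product over
   A yields a sum over edge sets, in which the sum over x factorises into the
   moments E_(b_i)[(x_i xi_i^(- x_i))^n] = (-1)^n f_n(gamma_i). *)

(** * Products of subset sums as a sum over edge sets *)

(** The type [{set members A}] varies with [A]. Moving the sum to subsets of the ambient type lets a
    product over [A] be expanded over functions with one fixed codomain. *)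
Lemma sum_members_subsets (R : comNzRingType) (I : finType) (A : {set I})
    (b : {set members A} -> R) (t : I -> R) :
  \sum_(J : {set members A}) b J * \prod_(i in J) t (val i) =
  \sum_(T : {set I} | T \subset A)
    b [set i | val i \in T] * \prod_(i in T) t i.
Proof.
rewrite [RHS](reindex_onto (fun J : {set members A} => [set val i | i in J])
  (fun T : {set I} => [set i : members A | val i \in T])) /=; last first.
  move=> T /fintype.subsetP TA; apply/finset.setP => i; apply/imsetP/idP.
    by case=> j; rewrite inE => jT ->.
  by move=> iT; exists (exist _ i (TA i iT)); rewrite ?inE.
have valK (J : {set members A}) :
    [set i : members A | val i \in [set val j | j in J]] = J.
  by apply/finset.setP => i; rewrite inE (finset.mem_imset _ _ val_inj).
apply: eq_big => [J|J _].
  rewrite valK eqxx andbT; apply/esym/fintype.subsetP => _ /imsetP[j _ ->].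
  exact: (valP j).
by rewrite valK big_imset //= => i j _ _; apply: val_inj.
Qed.

Lemma prod_edge_degree (R : comNzRingType) (N : nat)
    (s : {set 'I_N * {set 'I_N}}) (t : 'I_N -> R) :
  \prod_(e in s) t e.1 = \prod_(i < N) t i ^+ edge_degree s i.
Proof.
rewrite (partition_big (fun e : 'I_N * {set 'I_N} => e.1) xpredT) //=.
apply: eq_bigr => i _; rewrite /edge_degree -prodr_const.
by apply: eq_big => [e|e /andP[_ /eqP ->]] //; rewrite !inE.
Qed.

(** Choosing a subset of each [A] in [F] amounts to choosing an edge set [s]: the subset chosen in
    [A] is the fibre of [s] over [A]. A vertex [i] then contributes [t i] once for each edge of [s]
    at [i]. *)
Lemma prod_sum_edge_sets (R : comNzRingType) (N : nat) (F : {set {set 'I_N}})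
    (b : forall A : {set 'I_N}, {set members A} -> R) (t : 'I_N -> R) :
  \prod_(A in F) \sum_(J : {set members A}) b A J * \prod_(i in J) t (val i) =
  \sum_(s : {set 'I_N * {set 'I_N}} | s \subset edges F)
    \prod_(A in F) b A (edge_trace s A) *
    \prod_(i < N) t i ^+ edge_degree s i.
Proof.
under eq_bigr do rewrite sum_members_subsets.
(* The default value [finset.set0] outside [F] expresses that [s] has no edge to a set outside
   [F]. *)
rewrite (big_distr_big_dep finset.set0) /=.
rewrite (reindex_onto
  (fun s : {set 'I_N * {set 'I_N}} =>
     [ffun A : {set 'I_N} => [set i | (i, A) \in s]])
  (fun f : {ffun {set 'I_N} -> {set 'I_N}} => [set e | e.1 \in f e.2])) /=;
  last by move=> f _; apply/ffunP => A; rewrite ffunE;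
    apply/finset.setP => i; rewrite !inE.
apply: eq_big => [s|s].
  have -> : [set e | e.1 \in
      [ffun A : {set 'I_N} => [set i | (i, A) \in s]] e.2] = s.
    by apply/finset.setP => -[i A]; rewrite inE ffunE inE.
  rewrite eqxx andbT; apply/pfamilyP/fintype.subsetP;
    [move=> [/supportP sF sA] [i A] es | move=> sF].
    have AF : A \in F.
      apply: contraT => /sF; rewrite ffunE => /finset.setP/(_ i).
      by rewrite !inE es.
    rewrite inE /= AF; have := sA A AF; rewrite unfold_in ffunE.
    by move=> /fintype.subsetP; apply; rewrite inE.
  split=> [|A AF].
    apply/supportP => A AF; rewrite ffunE; apply/finset.setP => i.
    rewrite !inE; apply/negP => /sF; rewrite inE /= => /andP[+ _].
    exact/negP.
  rewrite unfold_in ffunE; apply/fintype.subsetP => i; rewrite inE => /sF.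
  by rewrite inE /= => /andP[].
move=> /andP[/pfamilyP[/supportP sF _] _].
rewrite big_split /=; congr (_ * _).
  apply: eq_bigr => A _; congr (b A _).
  by apply/finset.setP => i; rewrite !inE ffunE inE.
rewrite -prod_edge_degree (exchange_big_dep xpredT) //= pair_big_dep /=.
apply: eq_bigl => -[i A]; rewrite /= ffunE inE andbC.
(* An edge of [s] makes the fibre over [A] nonempty, so the support condition forces [A] into
   [F]. *)
case: (boolP ((i, A) \in s)) => //= es.
apply: contraT => /sF; rewrite ffunE => /finset.setP/(_ i).
by rewrite !inE es.
Qed.

(* [x] and [- x^-1] are the two roots of [r^2 = (x - x^-1) r + 1], so the two
   sides obey the same recurrence. *)
Lemma fpoly_sub_invE (R : realType) (x : R) (n : nat) : 0 < x ->
  (x * (x^-1) ^+ n + x^-1 * (- x) ^+ n) / (x + x^-1) =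
  (-1) ^+ n * (fpoly R n).[x - x^-1].
Proof.
move=> x_gt0.
have x0 : x != 0 by rewrite gt_eqF.
have x20 : x * x + 1 != 0 by rewrite gt_eqF // addr_gt0 // mulr_gt0.
elim/ltn_ind: n => -[|[|n]] IH.
- by rewrite !expr0 hornerC; field; rewrite x0 x20.
- by rewrite !expr1 horner0; field; rewrite x0 x20.
have -> : fpoly R n.+2 = 'X * fpoly R n.+1 + fpoly R n by [].
rewrite hornerD hornerM hornerX mulrDr.
have -> : (-1) ^+ n.+2 * ((x - x^-1) * (fpoly R n.+1).[x - x^-1]) =
    - (x - x^-1) * ((-1) ^+ n.+1 * (fpoly R n.+1).[x - x^-1]).
  by rewrite [(-1) ^+ n.+2]exprS; ring.
have -> : (-1) ^+ n.+2 = (-1) ^+ n :> R by rewrite !exprS mulrA mulrNN !mul1r.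
rewrite -!IH // !exprS.
move: (x^-1 ^+ n) ((- x) ^+ n) => u v.
by field; rewrite x0 x20.
Qed.

Lemma ln_prod (R : realType) (I : Type) (r : seq I) (P : pred I) (f : I -> R) :
  (forall i, P i -> 0 < f i) ->
  ln (\prod_(i <- r | P i) f i) = \sum_(i <- r | P i) ln (f i).
Proof.
move=> f_gt0; rewrite -[RHS]expRK expR_sum; congr ln.
by apply: eq_bigr => i Pi; rewrite lnK // posrE f_gt0.
Qed.

(** * Beliefs at a fixed point: positivity, parametrization, moments, marginals *)

Section FixedPoint.
Variables (R : realType) (N : nat) (F : {set {set 'I_N}}).
Variable psi : forall A : {set 'I_N}, local_config A -> R.
Variable mu : {set 'I_N} -> 'I_N -> bool -> R.
Variable nu : 'I_N -> {set 'I_N} -> bool -> R.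
Hypothesis psi_gt0 : forall A, A \in F -> forall y, 0 < psi (A := A) y.
Hypothesis fixed_point : lbp_fixed_point F psi mu nu.

Local Notation vb := (vertex_belief F mu).
Local Notation fb := (factor_belief psi nu).

Lemma mu_gt0 A i a : A \in F -> i \in A -> 0 < mu A i a.
Proof. by move=> AF iA; have [] := fixed_point AF (exist _ i iA). Qed.

Lemma nu_gt0 A i a : A \in F -> i \in A -> 0 < nu i A a.
Proof. by move=> AF iA; have [] := fixed_point AF (exist _ i iA). Qed.

Lemma vertex_weight_gt0 i a : 0 < vertex_weight F mu i a.
Proof. by apply: prodr_gt0 => B /andP[BF iB]; apply: mu_gt0. Qed.

Lemma vertex_weight_sum_gt0 i : 0 < \sum_(a : bool) vertex_weight F mu i a.
Proof. by rewrite big_bool addr_gt0 ?vertex_weight_gt0. Qed.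

Lemma vertex_belief_gt0 i a : 0 < vb i a.
Proof. by rewrite divr_gt0 ?vertex_weight_sum_gt0 ?vertex_weight_gt0. Qed.

Lemma sum_vertex_belief i : \sum_(a : bool) vb i a = 1.
Proof. by rewrite -mulr_suml divff // gt_eqF // vertex_weight_sum_gt0. Qed.

Lemma xi_gt0 i : 0 < xi F mu i.
Proof. by rewrite sqrtr_gt0 divr_gt0 ?vertex_belief_gt0. Qed.

Lemma vertex_beliefE i a :
  vb i a = xi F mu i ^ spin a / (xi F mu i + (xi F mu i)^-1).
Proof.
have x_gt0 := xi_gt0 i.
have sum1 := sum_vertex_belief i; rewrite big_bool in sum1.
have trueE : vb i true = xi F mu i ^+ 2 * vb i false.
  rewrite sqr_sqrtr; first by rewrite divfK // gt_eqF // vertex_belief_gt0.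
  by rewrite ltW // divr_gt0 ?vertex_belief_gt0.
move: (xi F mu i) x_gt0 trueE => x x_gt0 trueE.
have x0 : x != 0 by rewrite gt_eqF.
have x20 : x * x + 1 != 0 by rewrite gt_eqF // addr_gt0 // mulr_gt0.
have falseE : vb i false = (x * x + 1)^-1.
  by apply: (mulfI x20); rewrite mulfV // mulrDl mul1r -expr2 -trueE.
by rewrite expz_spin; case: a; rewrite ?trueE falseE; field; rewrite x0 x20.
Qed.

Lemma gammaE i : gamma F mu i = xi F mu i - (xi F mu i)^-1.
Proof.
rewrite /gamma !vertex_beliefE !expz_spin.
have x_gt0 := xi_gt0 i; move: (xi F mu i) x_gt0 => x x_gt0.
have x0 : x != 0 by rewrite gt_eqF.
have s_gt0 : 0 < x + x^-1 by rewrite addr_gt0 ?invr_gt0.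
have s0 : x + x^-1 != 0 by rewrite gt_eqF.
have -> : x / (x + x^-1) * (x^-1 / (x + x^-1)) = ((x + x^-1)^-1) ^+ 2.
  by rewrite mulrACA divff // mul1r expr2.
by rewrite sqrtr_sqr gtr0_norm ?invr_gt0 // invrK -mulrBl divfK.
Qed.

(** The variable takes the values [xi^-1] and [- xi] with weights proportional to [xi] and [xi^-1],
    which is the left-hand side of [fpoly_sub_invE]. *)
Lemma vertex_moment i n :
  \sum_(a : bool) vb i a * ((spin a)%:~R / xi F mu i ^ spin a) ^+ n =
  (-1) ^+ n * (fpoly R n).[gamma F mu i].
Proof.
rewrite gammaE -fpoly_sub_invE ?xi_gt0 // big_bool !vertex_beliefE !expz_spin.
by rewrite /spin mulr1z mulrN1z invrK mul1r mulN1r mulrDl ![_ / _ * _]mulrAC.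
Qed.

Lemma factor_weight_gt0 A y : A \in F -> 0 < factor_weight psi nu (A := A) y.
Proof.
move=> AF; rewrite mulr_gt0 ?psi_gt0 // prodr_gt0 // => j _.
by rewrite nu_gt0 // (valP j).
Qed.

Lemma factor_weight_sum_gt0 A : A \in F ->
  0 < \sum_(y : local_config A) factor_weight psi nu y.
Proof.
move=> AF; rewrite (bigD1 [ffun=> true]) //= ltr_pwDl ?factor_weight_gt0 //.
by rewrite sumr_ge0 // => y _; rewrite ltW ?factor_weight_gt0.
Qed.

Lemma factor_belief_gt0 A y : A \in F -> 0 < fb (A := A) y.
Proof.
by move=> AF; rewrite divr_gt0 ?factor_weight_sum_gt0 ?factor_weight_gt0.
Qed.

Lemma sum_factor_belief A : A \in F -> \sum_(y : local_config A) fb y = 1.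
Proof.
by move=> AF; rewrite -mulr_suml divff // gt_eqF ?factor_weight_sum_gt0.
Qed.

(** The product defining [nu i A] omits exactly the factor [mu A i]; multiplying by it restores the
    full vertex weight. *)
Lemma nu_mu A i : A \in F -> i \in A ->
  exists2 c, 0 < c & forall a, nu i A a * mu A i a = c * vertex_weight F mu i a.
Proof.
move=> AF iA; have [_ _ _ [c c_gt0 nuE]] := fixed_point AF (exist _ i iA).
exists c => // a; rewrite nuE /= /vertex_weight [in RHS](bigD1 A) /= ?AF //.
under [in RHS]eq_bigl do rewrite -andbA.
by rewrite -mulrA [X in c * X]mulrC.
Qed.

(** Summing the factor weights with [y i] fixed gives [nu * mu] up to a constant, hence a multiple
    of the vertex weight by [nu_mu]. Normalization removes the multiple. *)
Lemma factor_belief_marginal (A : {set 'I_N}) (i : members A) a : A \in F ->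
  \sum_(y : local_config A | y i == a) fb y = vb (val i) a.
Proof.
move=> AF.
have [k k0 kE] : exists2 k : R, k != 0 & forall a',
    \sum_(y : local_config A | y i == a') factor_weight psi nu y =
    k * vertex_weight F mu (val i) a'.
  have [_ _ [c c_gt0 muE] _] := fixed_point AF i.
  have [c' c'_gt0 nu_muE] := nu_mu AF (valP i).
  exists (c' / c) => [|a']; first by rewrite gt_eqF // divr_gt0.
  rewrite mulrAC -nu_muE muE mulrCA [c * _]mulrC mulfK ?gt_eqF // mulr_sumr.
  apply: eq_bigr => y /eqP <-.
  by rewrite /factor_weight (bigD1 i) //= mulrCA.
rewrite -mulr_suml kE.
rewrite (partition_big (fun y : local_config A => y i) xpredT) //=.
under [X in _ / X]eq_bigr do rewrite kE.
by rewrite -mulr_sumr -mulf_div divff // mul1r.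
Qed.

Lemma factor_belief_expectation (A : {set 'I_N}) (i : members A)
    (g : bool -> R) : A \in F ->
  \sum_(y : local_config A) fb y * g (y i) = \sum_(a : bool) vb (val i) a * g a.
Proof.
move=> AF; rewrite (partition_big (fun y : local_config A => y i) xpredT) //=.
apply: eq_bigr => a _; rewrite -factor_belief_marginal // mulr_suml.
by apply: eq_bigr => y /eqP ->.
Qed.

(** * The Bethe approximation and the factorization of the model through beliefs *)

Lemma sum_members_exchange (g : 'I_N -> {set 'I_N} -> R) :
  \sum_(A in F) \sum_(j : members A) g (val j) A =
  \sum_(i < N) \sum_(A in F | i \in A) g i A.
Proof.
rewrite [RHS](exchange_big_dep (mem F)) /=; last by move=> i A _ /andP[].
apply: eq_bigr => A AF; rewrite -(big_sub (mem A) (g ^~ A)).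
by apply: eq_bigl => i; rewrite AF.
Qed.

(* Up to an additive constant this is [ln (mu A i a)], by [nu_mu]. *)
Definition log_ratio i A a : R := ln (vb i a) - ln (nu i A a).

(** The choice of [true] is immaterial: [sum_log_ratio] shows that [false] gives the same number. *)
Definition log_shift i : R :=
  \sum_(A in F | i \in A) log_ratio i A true - ln (vb i true).

Definition log_bethe : R :=
  \sum_(A in F) ln (\sum_(y : local_config A) factor_weight psi nu y) +
  \sum_(i < N) log_shift i.

(** Both the sum of the [log_ratio i A a] and [ln (vb i a)] equal the sum of the [ln (mu A i a)] up
    to terms independent of [a]. Their difference is therefore its value at [true]. *)
Lemma sum_log_ratio i a :
  \sum_(A in F | i \in A) log_ratio i A a = ln (vb i a) + log_shift i.
Proof.
have vbE b : ln (vb i b) = \sum_(A in F | i \in A) ln (mu A i b) -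
    ln (\sum_(b' : bool) vertex_weight F mu i b').
  rewrite ln_div ?posrE ?vertex_weight_gt0 ?vertex_weight_sum_gt0 //.
  by rewrite ln_prod // => A /andP[AF iA]; apply: mu_gt0.
have lrE : \sum_(A in F | i \in A) (log_ratio i A a - ln (mu A i a)) =
    \sum_(A in F | i \in A) (log_ratio i A true - ln (mu A i true)).
  apply: eq_bigr => A /andP[AF iA]; have [c c_gt0 nu_muE] := nu_mu AF iA.
  have ln_nu b : ln (nu i A b) =
      ln c + ln (vertex_weight F mu i b) - ln (mu A i b).
    rewrite -lnM ?posrE ?vertex_weight_gt0 // -nu_muE.
    by rewrite lnM ?posrE ?mu_gt0 ?nu_gt0 // addrK.
  rewrite /log_ratio !ln_nu !ln_div ?posrE
    ?vertex_weight_gt0 ?vertex_weight_sum_gt0 //.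
  ring.
rewrite /log_shift !vbE.
move: lrE; rewrite !sumrB => lrE.
apply: (@addIr _ (- \sum_(A in F | i \in A) ln (mu A i a))).
rewrite lrE; ring.
Qed.

(** Beyond [ln (fb y)] there remain only a constant and terms in single coordinates, each equal to
    [- ln nu]. Such terms can be averaged using the vertex beliefs alone. *)
Lemma ln_psi (A : {set 'I_N}) (y : local_config A) : A \in F ->
  ln (psi y) = ln (fb y) +
    (ln (\sum_(y' : local_config A) factor_weight psi nu y') +
     \sum_(j : members A) (log_ratio (val j) A (y j) - ln (vb (val j) (y j)))).
Proof.
move=> AF.
have nu_y_gt0 (j : members A) : 0 < nu (val j) A (y j).
  by apply: nu_gt0 => //; apply: (valP j).
rewrite ln_div ?posrE ?factor_weight_gt0 ?factor_weight_sum_gt0 //.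
have nu_prod_gt0 : 0 < \prod_(j : members A) nu (val j) A (y j).
  by apply: prodr_gt0.
rewrite addrA subrK lnM ?posrE ?psi_gt0 // ln_prod; last by move=> j _.
rewrite -addrA -big_split big1 ?addr0 //= => j _.
by rewrite /log_ratio; ring.
Qed.

(** After averaging, vertex [i] carries [ln (vb i a)] with coefficient [1] from [sum_log_ratio],
    minus [degree F i] from [ln_psi], plus [degree F i - 1] from the entropy term. These cancel and
    leave [log_shift i]. *)
Lemma bethe_logE : bethe_log F psi mu nu = log_bethe.
Proof.
rewrite /bethe_log -sumrB.
have -> : \sum_(A in F) (\sum_(y : local_config A) fb y * ln (psi y) -
      \sum_(y : local_config A) fb y * ln (fb y)) =
    \sum_(A in F) ln (\sum_(y : local_config A) factor_weight psi nu y) +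
    \sum_(A in F) \sum_(j : members A) \sum_(a : bool)
      vb (val j) a * (log_ratio (val j) A a - ln (vb (val j) a)).
  rewrite -big_split; apply: eq_bigr => A AF /=.
  rewrite -sumrB.
  under [LHS]eq_bigr => y _ do
    rewrite -mulrBr ln_psi // [X in _ * X]addrAC subrr add0r mulrDr mulr_sumr.
  rewrite big_split -mulr_suml sum_factor_belief // mul1r; congr (_ + _).
  rewrite exchange_big; apply: eq_bigr => j _ /=.
  exact: (factor_belief_expectation j
    (fun a => log_ratio (val j) A a - ln (vb (val j) a)) AF).
rewrite /log_bethe -addrA; congr (_ + _).
rewrite (sum_members_exchange (fun i A => \sum_(a : bool)
  vb i a * (log_ratio i A a - ln (vb i a)))).
rewrite -big_split; apply: eq_bigr => i _ /=.
rewrite exchange_big /= mulr_sumr -big_split /=.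
(* Writing [1] as the total mass of [vb i] puts the constant [log_shift i] under the same average as
   the left-hand side. *)
rewrite -[RHS]mul1r -[X in _ = X * _](sum_vertex_belief i) mulr_suml.
apply: eq_bigr => a _; rewrite -mulr_sumr sumrB sum_log_ratio sumr_const.
have -> : #|[pred A in F | i \in A]| = degree F i.
  by apply: eq_card => A; rewrite !inE.
by rewrite -(mulr_natl (ln (vb i a))); ring.
Qed.

Lemma prod_psiE x :
  \prod_(A in F) psi (Defs.restrict A x) = bethe_Z F psi mu nu *
    (\prod_(A in F) (fb (Defs.restrict A x) / \prod_(i in A) vb i (x i)) *
     \prod_(i < N) vb i (x i)).
Proof.
have vbx_gt0 i : 0 < vb i (x i) by apply: vertex_belief_gt0.
rewrite /bethe_Z bethe_logE.
have -> : \prod_(A in F) psi (Defs.restrict A x) =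
    \prod_(A in F) (fb (Defs.restrict A x) / \prod_(i in A) vb i (x i) *
      expR (ln (\sum_(y : local_config A) factor_weight psi nu y) +
            \sum_(j : members A) log_ratio (val j) A (x (val j)))).
  apply: eq_bigr => A AF; rewrite big_sub -[LHS]lnK ?posrE ?psi_gt0 //.
  rewrite ln_psi // expRD lnK ?posrE ?factor_belief_gt0 // -mulrA.
  congr (_ * _).
  rewrite sumrB addrA expRB mulrC; congr (_ ^-1 * expR (_ + _)).
    rewrite expR_sum; apply: eq_bigr => j _.
    by rewrite ffunE lnK ?posrE.
  by apply: eq_bigr => j _; rewrite ffunE.
(* The exponentials regroup by vertex: [sum_log_ratio] yields the factors [vb i (x i)], and the
   constants add up to [log_bethe]. *)
rewrite big_split /= mulrCA; congr (_ * _).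
rewrite -expR_sum big_split /=.
rewrite (sum_members_exchange (fun i A => log_ratio i A (x i))).
under [X in _ + X]eq_bigr do rewrite sum_log_ratio.
rewrite big_split /= addrCA expRD mulrC; congr (_ * _).
by rewrite expR_sum; apply: eq_bigr => i _; rewrite lnK ?posrE.
Qed.

(** * Expansion in [beta] and summation over configurations *)

(** The normalizers [xi + xi^-1] of the two beliefs cancel. Dividing by all [xi ^ spin] then removes
    the factors outside [J] and leaves an inverse on each factor in [J]. *)
Lemma factor_belief_ratio (A : {set 'I_N}) (b : {set members A} -> R) x :
  is_beta F psi mu nu b ->
  fb (Defs.restrict A x) / \prod_(i in A) vb i (x i) =
  \sum_(J : {set members A}) b J *
    \prod_(i in J)
      ((spin (x (val i)))%:~R / xi F mu (val i) ^ spin (x (val i))).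
Proof.
case=> _ _ ->.
have xi_neq0 i : xi F mu i != 0 by rewrite gt_eqF // xi_gt0.
have xi_spin_neq0 (J : {pred members A}) :
    \prod_(i in J) xi F mu (val i) ^ spin (x (val i)) != 0.
  by apply/prodf_neq0 => i _; rewrite expfz_neq0.
under [X in _ / X]eq_bigr do rewrite vertex_beliefE //.
rewrite prodf_div [X in _ * _ / (X / _)]big_sub.
set P := \prod_(i in A) (_ + _); set S := \sum_J _.
have P_neq0 : P != 0.
  by apply/prodf_neq0 => i _; rewrite gt_eqF // addr_gt0 ?invr_gt0 ?xi_gt0.
have -> W : P^-1 * S / (W / P) = S / W.
  by rewrite invf_div mulrACA mulVf // mul1r.
rewrite mulr_suml; apply: eq_bigr => J _.
rewrite [X in _ / X](bigID (mem J)) /= prodf_div -!mulrA; congr (_ * _).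
under eq_bigr do rewrite ffunE.
rewrite [X in _ * (X * _)](eq_bigl (fun j => j \notin J)) => [|j]; last first.
  by rewrite finset.in_setC.
under [X in _ * (X * _)]eq_bigr do rewrite ffunE.
by rewrite invfM [X in _ * X]mulrCA divff ?mulr1 // (xi_spin_neq0 [predC J]).
Qed.

End FixedPoint.

Theorem theorem5 (R : realType) (N : nat) (F : {set {set 'I_N}})
    (psi : forall A : {set 'I_N}, local_config A -> R)
    (mu : {set 'I_N} -> 'I_N -> bool -> R)
    (nu : 'I_N -> {set 'I_N} -> bool -> R)
    (beta : forall A : {set 'I_N}, {set members A} -> R)
    (F_nonempty : forall A, A \in F -> A != finset.set0)
    (psi_gt0 : forall A, A \in F -> forall y, 0 < psi A y)
    (fixed_point : lbp_fixed_point F psi mu nu)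
    (betaP : forall A, A \in F -> is_beta F psi mu nu (beta A)) :
  partition_function F psi =
    bethe_Z F psi mu nu *
    \sum_(s : {set 'I_N * {set 'I_N}} | s \subset edges F)
      (-1) ^+ #|s| *
      \prod_(A in F) beta A (edge_trace s A) *
      \prod_(i < N) (fpoly R (edge_degree s i)).[gamma F mu i].
Proof.
rewrite /partition_function.
under eq_bigr do rewrite (prod_psiE psi_gt0 fixed_point).
rewrite -mulr_sumr; congr (_ * _).
pose t i a : R := (spin a)%:~R / xi F mu i ^ spin a.
under eq_bigr => x _.
  under eq_bigr => A AF do
    rewrite (factor_belief_ratio fixed_point _ (betaP A AF)).
  rewrite (prod_sum_edge_sets F beta (fun i => t i (x i))) mulr_suml.
  over.
rewrite exchange_big; apply: eq_bigr => s _ /=.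
under eq_bigr do rewrite -mulrA -big_split /=.
rewrite -mulr_sumr [X in _ = X * _]mulrC -mulrA; congr (_ * _).
(* For fixed [s] the summand is a product of functions of single coordinates, so the sum over [x]
   splits into one moment per vertex. *)
rewrite -(bigA_distr_bigA (fun i a =>
  t i a ^+ edge_degree s i * vertex_belief F mu i a)) /=.
under eq_bigr => i _.
  under eq_bigr do rewrite mulrC.
  rewrite (vertex_moment fixed_point).
  over.
(* The signs of the moments collect into [(-1) ^+ #|s|], by [prod_edge_degree] at the constant
   function [-1]. *)
by rewrite big_split /= -prod_edge_degree prodr_const.
Qed.
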